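(* Let $n$ be a nonnegative integer. Let $a_1, a_2, \ldots, a_n$ and $a$ be $n+1$ nonnegative reals. Let $S$ be a finite set. For every $s\in S$, let $r_{s,1}, r_{s,2}, \ldots, r_{s,n}$ be $n$ nonnegative reals, and let $b_s$ be a nonnegative real. Assume that the following two assertions hold: $$a_i + a = \sum_{s\in S} b_s r_{s,i}\quad\text{for every } i\in\{1,2,\ldots,n\};$$ $$a_i + a_j \geq \sum_{s\in S} b_s\left| r_{s,i}-r_{s,j}\right|\quad\text{for any two distinct integers } i \text{ and } j \text{ from } \{1,2,\ldots,n\}.$$ Let $f$ be a convex function from an interval $I\subseteq\mathbb{R}$ to $\mathbb{R}$. Let $w_1, w_2, \ldots, w_n$ be nonnegative reals. Assume that $\sum_{v=1}^n w_v\neq 0$ and that $\sum_{v=1}^n r_{s,v}w_v\neq 0$ for all $s\in S$. Let $x_1, x_2,\ldots, x_n$ be $n$ points from the interval $I$. Then $$\sum_{i=1}^n a_i w_i f(x_i) + a\left(\sum_{v=1}^n w_v\right) f\left(\frac{\sum_{v=1}^n w_v x_v}{\sum_{v=1}^n w_v}\right) \geq \sum_{s\in S} b_s\left(\sum_{v=1}^n r_{s,v}w_v\right) f\left(\frac{\sum_{v=1}^n r_{s,v}w_v x_v}{\sum_{v=1}^n r_{s,v}w_v}\right).$$ *)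

(* Defs.v *)
From mathcomp Require Import all_boot all_order all_algebra.
From mathcomp Require Import all_classical all_reals all_analysis.

Set Implicit Arguments.
Unset Strict Implicit.
Unset Printing Implicit Defensive.

(* Main.v *)
Require Import Defs.
From mathcomp Require Import all_boot all_order all_algebra.
From mathcomp Require Import all_classical all_reals all_analysis.
From mathcomp Require Import ring lra.

Import Order.TTheory GRing.Theory Num.Theory.
Local Open Scope classical_set_scope.
Local Open Scope ring_scope.

(** With the means [m] and [z s] of the [x v] for the weights [w v] and
    [r s v * w v], the claim compares two weighted families of points of equal
    total mass and equal barycentre.  Interpolating [f] at the points [x v], [m]
    by a polygonal function, that is, an affine function plus nonnegative
    multiples of functions [max 0 (x - t)], reduces it to [f x = `|x - t|].
    With [y v = w v * (x v - t)] this special case is an inequality of Hlawka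
    type, in which [w] no longer appears. *)

(** * Polygonal interpolation of convex functions *)

Lemma convex_function_chord (R : realType) (I : interval R) (f : R -> R) :
  convex_function ([set` I] : set R^o) f ->
  forall u v z, u \in I -> v \in I -> u <= z <= v ->
  (v - u) * f z <= (v - z) * f u + (z - u) * f v.
Proof.
move=> fc u v z uI vI /andP[uz zv].
have := le_trans uz zv; rewrite le_eqVlt => /predU1P[uv|uv].
  have -> : z = u by lra.
  by rewrite -uv !subrr !mul0r addr0.
have vu0 : 0 < v - u by rewrite subr_gt0.
have t0 : 0 <= (v - z) / (v - u) by rewrite divr_ge0 ?subr_ge0 // ltW.
have t1 : (v - z) / (v - u) <= 1 by rewrite ler_pdivrMr // mul1r lerB.
pose c := (v - z) / (v - u).
have : f (c * u + (1 - c) * v) <= c * f u + (1 - c) * f v.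
  by apply: (fc (Itv01 t0 t1) u v); rewrite inE.
rewrite /c; have -> : (v - z) / (v - u) * u + (1 - (v - z) / (v - u)) * v = z.
  by field; rewrite gt_eqF.
rewrite -(ler_pM2l vu0) => /le_trans; apply.
by rewrite le_eqVlt; apply/orP; left; apply/eqP; field; rewrite gt_eqF.
Qed.

(** Inductive, so that an inequality linear in the function can be checked one hinge at a time. *)
Inductive polygonal (R : realType) : (R -> R) -> Prop :=
| polygonal_affine p q : polygonal R (fun x => p * x + q)
| polygonal_hinge g c t : polygonal R g -> 0 <= c ->
    polygonal R (fun x => g x + c * Num.max 0 (x - t)).

(* The auxiliary point [u] records that the last segment, prolonged to the
   right, stays below [f]: this makes the next slope change nonnegative.  A
   one-sided derivative at [t] would not do, since it may be infinite at an
   endpoint of [I]. *)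
Lemma convex_polygonal_interpolation (R : realType) (I : interval R)
    (f : R -> R) (t : R) (s : seq R) :
  convex_function ([set` I] : set R^o) f ->
  sorted >=%O (t :: s) -> {subset t :: s <= I} ->
  forall u, u \in I -> t <= u ->
  exists g, [/\ polygonal R g, {in t :: s, g =1 f},
    forall z v, v \in t :: s -> v <= z <= t -> f z <= g z,
    g u <= f u & exists p q, forall x, t <= x -> g x = p * x + q].
Proof.
move=> /convex_function_chord fc; elim: s t => [|t' s IH] t.
  move=> _ sI u uI tu.
  (* Slope of the chord over [t] and [u]; for [u = t] the quotient is 0 and the line is constant. *)
  pose p := (f u - f t) / (u - t).
  have pE : u - t != 0 -> p * (u - t) = f u - f t by move=> ?; rewrite divfK.
  exists (fun x => p * x + (f t - p * t)); split.
  - exact: polygonal_affine.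
  - by move=> v; rewrite inE => /eqP ->; ring.
  - move=> z v; rewrite inE => /eqP -> ztt.
    have -> : z = t by lra.
    by rewrite addrC subrK.
  - have [->|ut] := eqVneq u t; first by rewrite addrC subrK.
    by rewrite addrCA -mulrBr pE ?subr_eq0 // addrC subrK.
  - by exists p, (f t - p * t).
rewrite /= => /andP[t't ss] sI u uI tu.
have sI' : {subset t' :: s <= I} by move=> v vs; apply: sI; rewrite inE vs orbT.
have tI : t \in I by apply: sI; rewrite mem_head.
have t'I : t' \in I by apply: sI'; rewrite mem_head.
move: (t't); rewrite le_eqVlt => /predU1P[t'E|t'lt].
  have [g [pg gf fg gu gl]] := IH _ ss sI' _ uI (le_trans t't tu).
  exists g; rewrite -t'E; split => //.
    by move=> v; rewrite inE => /predU1P[->|/gf//]; apply: gf; rewrite mem_head.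
  move=> z v; rewrite inE => /predU1P[->|]; last exact: fg.
  by apply: fg; rewrite mem_head.
(* Taking [u := t] in the induction hypothesis gives [g t <= f t]. A hinge at [t'] of slope [c >= 0]
   lifts this value to [f t] and changes nothing up to [t']; beyond [t'] the new function is the
   line through the graph points over [t'] and [t]. *)
have [g [pg gf fg gt [p [q gl]]]] := IH _ ss sI' _ tI t't.
have tt'0 : t - t' != 0 by rewrite subr_eq0 gt_eqF.
pose c := (f t - g t) / (t - t').
have c0 : 0 <= c by rewrite divr_ge0 // subr_ge0.
have gt'E : p * t' + q = f t' by rewrite -gl ?gf ?mem_head.
have gE x : t' <= x -> g x + c * Num.max 0 (x - t') =
    f t' + (f t - f t') / (t - t') * (x - t').
  move=> t'x; rewrite max_r ?subr_ge0 // /c !gl // -gt'E.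
  by field.
have gE' x : x <= t' -> g x + c * Num.max 0 (x - t') = g x.
  by move=> xt'; rewrite max_l ?mulr0 ?addr0 // subr_le0.
exists (fun x => g x + c * Num.max 0 (x - t')); split.
- exact: polygonal_hinge.
- move=> v; rewrite inE => /predU1P[->|vs].
    by rewrite gE //; field.
  rewrite gE' ?gf //.
  move: vs; rewrite inE => /predU1P[->//|].
  by move: ss; rewrite (path_sortedE ge_trans) => /andP[/allP + _] => /[apply].
- move=> z v vs /andP[vz zt].
  have [zt'|/ltW t'z] := leP z t'.
    rewrite gE'//; move: vs; rewrite inE => /predU1P[vt|vs]; first by lra.
    by apply: fg vs _; rewrite vz.
  rewrite gE // -(@ler_pM2l _ (t - t')) ?subr_gt0 //.
  have := fc t' t z t'I tI; rewrite t'z zt => /(_ isT) /le_trans; apply.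
  by rewrite le_eqVlt; apply/orP; left; apply/eqP; field.
(* The chord over [t'] and [t], prolonged to [u], stays below [f]: apply convexity to
   [t' <= t <= u]. *)
- rewrite gE ?(le_trans t't) // -(@ler_pM2l _ (t - t')) ?subr_gt0 //.
  have := fc t' u t t'I uI; rewrite t't tu => /(_ isT) h.
  have -> : (t - t') * (f t' + (f t - f t') / (t - t') * (u - t')) =
      (t - t') * f t' + (f t - f t') * (u - t').
    by field.
  by lra.
- exists ((f t - f t') / (t - t')), (f t' - (f t - f t') / (t - t') * t').
  move=> x tx.
  by rewrite gE ?(le_trans t't)//; ring.
Qed.

(** * A weighted Karamata inequality *)

(** Replace [f] by a polygonal [g] that equals [f] at every [y j] and dominates it between them: the
    sum over [J] is unchanged, and the sum over [K] can only grow, since [hull] puts each [z k]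
    between two of the [y j]. *)
Lemma weighted_karamata (R : realType) (J K : finType)
    (al y : J -> R) (be z : K -> R) (I : interval R) (f : R -> R) :
  convex_function ([set` I] : set R^o) f ->
  (forall j, y j \in I) -> (forall k, 0 <= be k) ->
  (forall k, exists j j', y j <= z k <= y j') ->
  \sum_j al j = \sum_k be k ->
  \sum_j al j * y j = \sum_k be k * z k ->
  (forall t, \sum_k be k * `|z k - t| <= \sum_j al j * `|y j - t|) ->
  \sum_k be k * f (z k) <= \sum_j al j * f (y j).
Proof.
move=> fc yI be0 hull mass mean absle.
have Pg g : polygonal R g -> \sum_k be k * g (z k) <= \sum_j al j * g (y j).
  elim=> {g}[p q|g c t _ IH c0].
    have E (L : finType) (d h : L -> R) :
        \sum_l d l * (p * h l + q) = p * (\sum_l d l * h l) + q * \sum_l d l.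
      by rewrite !mulr_sumr -big_split; apply: eq_bigr => l _ /=; ring.
    by rewrite !E mass mean.
  (* Since [max 0 u = (|u| + u) / 2], a hinge only involves the absolute moment at [t], the mean and
     the mass. *)
  have E (L : finType) (d h : L -> R) :
      \sum_l d l * (g (h l) + c * Num.max 0 (h l - t)) =
      \sum_l d l * g (h l) +
      c / 2 * (\sum_l d l * `|h l - t| + \sum_l d l * h l - t * \sum_l d l).
    rewrite [t * _]mulr_sumr -!sumrN -!big_split mulr_sumr -big_split.
    apply: eq_bigr => l _ /=.
    have [h0|/ltW h0] := leP 0 (h l - t).
      by rewrite ger0_norm//; field.
    by rewrite ler0_norm//; field.
  by rewrite !E mass mean lerD // ler_wpM2l ?divr_ge0 // !lerD2r.
(* The head of the decreasing list is the greatest [y j]; if the list is empty, [hull] leaves no [k]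
   either. *)
pose s := sort >=%O [seq y j | j <- enum J].
have ys j : y j \in s by rewrite mem_sort map_f // mem_enum.
have sI : {subset s <= I} by move=> v; rewrite mem_sort => /mapP[j _ ->].
have ss : sorted >=%O s by apply: sort_sorted => u v; apply: ge_total.
case: s ys sI ss => [|t s] ys sI ss.
  rewrite !big1 // => [j _|k _]; first by have := ys j.
  by have [j] := hull k; have := ys j.
have tI : t \in I by apply: sI; rewrite mem_head.
have [g [pg gf fg _ _]] :=
  convex_polygonal_interpolation _ _ _ _ _ fc ss sI t tI (lexx t).
have yt j : y j <= t.
  have := ys j; rewrite inE => /predU1P[->//|].
  move: ss; rewrite /= (path_sortedE ge_trans) => /andP[/allP + _].
  by move=> /[apply].
have := Pg g pg; under [X in _ <= X -> _]eq_bigr do rewrite gf //.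
apply: le_trans; apply: ler_sum => k _; apply: ler_wpM2l => //.
have [j [j' /andP[jk kj']]] := hull k.
by apply: (fg _ (y j)); rewrite // jk (le_trans kj').
Qed.

(** * The inequality of Hlawka type *)

(* Assume [\sum_i y i >= 0] and let [p], [q] be the positive and negative parts
   of [y].  Spreading each [q j] over the indices [i] in proportion to [p i]
   compares [\sum_v r s v * y v] with the differences [r s j - r s i]. *)
Lemma weighted_hlawka_abs (R : realType) (n : nat) (a : 'I_n -> R) (a0 : R)
    (S : finType) (r : S -> 'I_n -> R) (b : S -> R) :
  (forall i, 0 <= a i) -> (forall s i, 0 <= r s i) -> (forall s, 0 <= b s) ->
  (forall i, a i + a0 = \sum_s b s * r s i) ->
  (forall i j, i != j -> \sum_s b s * `|r s i - r s j| <= a i + a j) ->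
  forall y : 'I_n -> R,
  \sum_s b s * `|\sum_v r s v * y v| <=
    \sum_i a i * `|y i| + a0 * `|\sum_i y i|.
Proof.
move=> a_ge0 r_ge0 b_ge0 sum_eq sum_le y.
wlog y0 : y / 0 <= \sum_i y i.
  move=> H; have [/H//|/ltW y0] := leP 0 (\sum_i y i).
  have := H (fun i => - y i); rewrite sumrN oppr_ge0 normrN => /(_ y0).
  under eq_bigr => s _.
    under eq_bigr do rewrite mulrN.
    rewrite sumrN normrN; over.
  by under [X in _ <= X + _ -> _]eq_bigr do rewrite normrN.
pose p i := (`|y i| + y i) / 2; pose q i := (`|y i| - y i) / 2.
have p0 i : 0 <= p i by rewrite /p; have := ler_norm (- y i); rewrite normrN; lra.
have q0 i : 0 <= q i by rewrite /q; have := ler_norm (y i); lra.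
have ypq i : y i = p i - q i by rewrite /p /q; field.
pose P := \sum_i p i; pose N := \sum_i q i.
have yPN : \sum_i y i = P - N by rewrite -sumrB; apply: eq_bigr.
have N0 : 0 <= N by apply: sumr_ge0.
have NP : N <= P by rewrite -subr_ge0 -yPN.
have [PE|P0] := eqVneq P 0.
  have NE : N = 0 by apply/le_anti; rewrite N0 -PE NP.
  have yE i : y i = 0.
    have /(_ i isT) pi0 := psumr_eq0P (fun i _ => p0 i) PE.
    have /(_ i isT) qi0 := psumr_eq0P (fun i _ => q0 i) NE.
    by rewrite ypq pi0 qi0 subrr.
  rewrite [X in X <= _]big1 => [|s _].
    rewrite yPN PE NE subrr normr0 mulr0 addr0.
    by apply: sumr_ge0 => i _; rewrite mulr_ge0.
  by rewrite big1 ?normr0 ?mulr0 // => v _; rewrite yE mulr0.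
have {P0} P0 : 0 < P by rewrite lt_neqAle eq_sym P0 (le_trans N0).
pose Z s := \sum_v r s v * y v.
pose d s i j := r s j - r s i.
have dd0 s i j : 0 <= `|d s i j| + d s i j.
  by have := ler_norm (- d s i j); rewrite normrN; lra.
(* If [Z s < 0], bounding [|d s i j|] below by [d s i j] leaves [2 * (P * \sum_j r s j * q j - N *
   \sum_i r s i * p i)], which is at least [- 2 * P * Z s] because [N <= P]. *)
have transport s :
    P * (`|Z s| - Z s) <= \sum_i \sum_j p i * q j * (`|d s i j| + d s i j).
  have [Z0|Z0] := leP 0 (Z s).
    rewrite ger0_norm // subrr mulr0.
    by apply: sumr_ge0 => i _; apply: sumr_ge0 => j _; exact: mulr_ge0 (mulr_ge0 _ _) _.
  rewrite ltr0_norm //.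
  apply: (@le_trans _ _ (\sum_i \sum_j p i * q j * (2 * d s i j))); last first.
    apply: ler_sum => i _; apply: ler_sum => j _.
    apply: ler_wpM2l; first exact: mulr_ge0.
    have := ler_norm (d s i j); lra.
  have -> : \sum_i \sum_j p i * q j * (2 * d s i j) =
      2 * (P * (\sum_j r s j * q j) - N * \sum_i r s i * p i).
    rewrite [P * _]mulr_suml [N * _]mulr_sumr -sumrB mulr_sumr.
    apply: eq_bigr => i _.
    rewrite [p i * _]mulr_sumr [N * _]mulr_suml -sumrB mulr_sumr.
    by apply: eq_bigr => j _; rewrite /d; ring.
  have -> : Z s = \sum_i r s i * p i - \sum_j r s j * q j.
    by rewrite -sumrB; apply: eq_bigr => i _; rewrite ypq; ring.
  have rp0 : 0 <= \sum_i r s i * p i by apply: sumr_ge0 => i _; rewrite mulr_ge0.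
  have := ler_wpM2r rp0 NP; lra.
(* In [\sum_s b s * d s i j = a j - a i] the constant [a0] has cancelled; adding the bound
   [a i + a j] on the absolute values cancels [a i]. *)
have cost i j : \sum_s b s * (`|d s i j| + d s i j) <= 2 * a j.
  have -> : \sum_s b s * (`|d s i j| + d s i j) =
      \sum_s b s * `|r s j - r s i| + (a j - a i).
    have -> : a j - a i = (a j + a0) - (a i + a0) by ring.
    rewrite !sum_eq -sumrB -big_split.
    by apply: eq_bigr => s _ /=; rewrite /d; ring.
  have [->|ij] := eqVneq j i.
    rewrite big1 => [|s _]; last by rewrite subrr normr0 mulr0.
    by have := a_ge0 i; lra.
  by have := sum_le _ _ ij; lra.
(* Weight [cost] by [p i * q j]: the sum over [i] yields the factor [P] of [transport], which is
   then cancelled. *)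
have key : \sum_s b s * (`|Z s| - Z s) <= 2 * \sum_j q j * a j.
  rewrite -(ler_pM2l P0).
  apply: (@le_trans _ _ (\sum_s b s *
      \sum_i \sum_j p i * q j * (`|d s i j| + d s i j))).
    rewrite [leLHS]mulr_sumr; apply: ler_sum => s _.
    by rewrite mulrCA ler_wpM2l.
  under eq_bigr do rewrite mulr_sumr.
  rewrite exchange_big /= [P * _]mulr_suml; apply: ler_sum => i _.
  under eq_bigr do rewrite mulr_sumr.
  rewrite exchange_big /= 2!mulr_sumr; apply: ler_sum => j _.
  have -> : \sum_s b s * (p i * q j * (`|d s i j| + d s i j)) =
      p i * q j * \sum_s b s * (`|d s i j| + d s i j).
    by rewrite mulr_sumr; apply: eq_bigr => s _; ring.
  apply: le_trans (ler_wpM2l (mulr_ge0 (p0 i) (q0 j)) (cost i j)) _.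
  by rewrite le_eqVlt; apply/orP; left; apply/eqP; ring.
(* Adding this to [key] cancels the terms [a i * y i] and leaves [a0 * \sum_i y i], whose sum is
   nonnegative by [y0]. *)
have ZE : \sum_s b s * Z s = \sum_i (a i + a0) * y i.
  under [RHS]eq_bigr do rewrite sum_eq mulr_suml.
  rewrite exchange_big /=; apply: eq_bigr => s _.
  by rewrite mulr_sumr; apply: eq_bigr => v _; ring.
have qE : 2 * (\sum_j q j * a j) = \sum_j a j * `|y j| - \sum_j a j * y j.
  by rewrite -sumrB mulr_sumr; apply: eq_bigr => j _; rewrite /q; field.
move: key; under eq_bigr do rewrite mulrBr.
rewrite sumrB ZE qE (ger0_norm y0).
under [X in _ - X <= _ -> _]eq_bigr do rewrite mulrDl.
rewrite big_split /= -mulr_sumr; lra.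
Qed.

(** Otherwise all deviations from the mean are positive; their weighted sum is 0, so every weight
    vanishes. *)
Lemma exists_le_weighted_mean (R : realType) (J : finType) (w x : J -> R) :
  (forall j, 0 <= w j) -> \sum_j w j != 0 ->
  exists j, x j <= (\sum_j w j * x j) / \sum_j w j.
Proof.
move=> w0 W0; set m := _ / _; apply: contrapT => /forallNP xm.
have h j : 0 <= w j * (x j - m).
  by rewrite mulr_ge0 // subr_ge0 ltW // ltNge; apply/negP/xm.
have hE : \sum_j w j * (x j - m) = 0.
  under eq_bigr do rewrite mulrBr.
  by rewrite sumrB -mulr_suml /m mulrCA divff // mulr1 subrr.
case/eqP: W0; apply: big1 => j _.
have /(_ j isT)/eqP := psumr_eq0P (fun j _ => h j) hE.
rewrite mulf_eq0 => /predU1P[//|]; rewrite subr_eq0 => /eqP xE.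
by have := xm j; rewrite xE lexx.
Qed.

Lemma exists_ge_weighted_mean (R : realType) (J : finType) (w x : J -> R) :
  (forall j, 0 <= w j) -> \sum_j w j != 0 ->
  exists j, (\sum_j w j * x j) / \sum_j w j <= x j.
Proof.
move=> w0 W0; have [j] := exists_le_weighted_mean _ _ w (fun j => - x j) w0 W0.
by under eq_bigr do rewrite mulrN; rewrite sumrN mulNr lerN2; exists j.
Qed.

(** * Masses, barycentres and absolute moments of the two families *)

Theorem theorem14 (R : realType) (n : nat) (a : 'I_n -> R) (a0 : R)
    (S : finType) (r : S -> 'I_n -> R) (b : S -> R)
    (a_ge0 : forall i, 0 <= a i) (a0_ge0 : 0 <= a0)
    (r_ge0 : forall s i, 0 <= r s i) (b_ge0 : forall s, 0 <= b s)
    (sum_eq : forall i, a i + a0 = \sum_(s : S) b s * r s i)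
    (sum_le : forall i j, i != j ->
       a i + a j >= \sum_(s : S) b s * `|r s i - r s j|)
    (I : interval R) (f : R -> R)
    (f_convex : convex_function ([set` I] : set R^o) f)
    (w : 'I_n -> R) (w_ge0 : forall i, 0 <= w i)
    (w_neq0 : \sum_(v < n) w v != 0)
    (rw_neq0 : forall s, \sum_(v < n) r s v * w v != 0)
    (x : 'I_n -> R) (x_in : forall i, x i \in I) :
  \sum_(i < n) a i * w i * f (x i)
  + a0 * (\sum_(v < n) w v)
       * f ((\sum_(v < n) w v * x v) / (\sum_(v < n) w v))
  >= \sum_(s : S) b s * (\sum_(v < n) r s v * w v)
       * f ((\sum_(v < n) r s v * w v * x v) / (\sum_(v < n) r s v * w v)).
Proof.
set W := \sum_v w v; set m := _ / W.
pose Rw s := \sum_v r s v * w v.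
pose z s := (\sum_v r s v * w v * x v) / Rw s.
have rw_ge0 s v : 0 <= r s v * w v by rewrite mulr_ge0.
have Rw_ge0 s : 0 <= Rw s by apply: sumr_ge0.
have W_ge0 : 0 <= W by apply: sumr_ge0.
have m_in : m \in I.
  have [i im] := exists_le_weighted_mean _ _ w x w_ge0 w_neq0.
  have [j mj] := exists_ge_weighted_mean _ _ w x w_ge0 w_neq0.
  apply: (@interval_is_interval _ I (x i) (x j)) => /=; [exact: x_in..|].
  by apply/andP.
pose al (j : 'I_n + unit) := if j is inl i then a i * w i else a0 * W.
pose y (j : 'I_n + unit) := if j is inl i then x i else m.
have sumJ (h : R -> R) : \sum_j al j * h (y j) =
    \sum_i a i * w i * h (x i) + a0 * W * h m.
  by rewrite big_sumType /= (big_pred1 tt) //; case.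
(* [c = w] gives equal masses, [c v = w v * (x v - 0)] equal barycentres. *)
have linear (c : 'I_n -> R) :
    \sum_s b s * (\sum_v r s v * c v) = \sum_i a i * c i + a0 * \sum_i c i.
  under eq_bigr do rewrite mulr_sumr.
  rewrite exchange_big mulr_sumr -big_split /=; apply: eq_bigr => i _.
  rewrite -mulrDl sum_eq mulr_suml; apply: eq_bigr => s _; ring.
(* Clearing the denominator of [z s] produces the sums of [weighted_hlawka_abs] for
   [y v = w v * (x v - t)]. *)
have RwM s t : Rw s * (z s - t) = \sum_v r s v * (w v * (x v - t)).
  rewrite mulrBr /z mulrCA divff ?rw_neq0 // mulr1 /Rw mulr_suml -sumrB.
  by apply: eq_bigr => v _; ring.
have WM t : W * (m - t) = \sum_v w v * (x v - t).
  rewrite mulrBr /m mulrCA divff // mulr1 /W mulr_suml -sumrB.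
  by apply: eq_bigr => v _; ring.
rewrite -sumJ.
apply: (weighted_karamata _ _ _ al y (fun s => b s * Rw s) z I) => //.
- by case.
- by move=> s; rewrite mulr_ge0.
- move=> s.
  have [i iz] := exists_le_weighted_mean _ _ _ x (rw_ge0 s) (rw_neq0 s).
  have [j zj] := exists_ge_weighted_mean _ _ _ x (rw_ge0 s) (rw_neq0 s).
  by exists (inl i), (inl j); apply/andP.
- under eq_bigr do rewrite -[al _]mulr1.
  rewrite (sumJ (fun=> 1)) linear mulr1; congr (_ + _).
  by apply: eq_bigr => i _; rewrite mulr1.
- apply: etrans (sumJ id) _; under [RHS]eq_bigr => s _.
    rewrite -mulrA -[z s]subr0 RwM; over.
  rewrite linear -WM subr0 mulrA; congr (_ + _).
  by apply: eq_bigr => i _; rewrite subr0 mulrA.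
- move=> t; rewrite [leRHS](sumJ (fun u => `|u - t|)).
  have := weighted_hlawka_abs _ _ _ _ _ _ _ a_ge0 r_ge0 b_ge0 sum_eq sum_le
    (fun v => w v * (x v - t)).
  under eq_bigr => s _ do rewrite -RwM normrM (ger0_norm (Rw_ge0 s)) mulrA.
  rewrite -WM normrM (ger0_norm W_ge0) mulrA => /le_trans; apply.
  rewrite lerD2r; apply: ler_sum => i _.
  by rewrite normrM (ger0_norm (w_ge0 i)) mulrA.
Qed.
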